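(* Let $q\ge5$ and $k\ge2$ be integers. With the notation of the context for the hyperbolic Pascal triangle $\mathcal{HPT}_{4,q}$, for all $n\ge1$ the following system of recurrences holds: $$(a^{k})_{n+1}= 2(a^{k})_{n} + 2\sum_{i=1}^{k-1}\binom{k}{i}(a^{k-i}b^{i})_{n}+ 2(b^{k})_{n} +(2^k-2)u_n-2,$$ for $j=1,\dots,k-1$, $$(a^{k-j}b^{j})_{n+1}= (a^{k})_{n}+ \sum_{i=0}^{k-j-1}\binom{k-j}{i}(a^{k-j-i}b^{j+i})_{n} + \sum_{i=0}^{k-j-1}\binom{k-j}{i}(a^{j+i}b^{k-j-i})_{n} + (b^{k})_{n}+ (2^{k-j}-1) u_n -1,$$ and $$(b^k)_{n+1} = (q-4)(a^k)_{n}+(q-3)(b^k)_{n}-2 (q-4),$$ $$u_{n+1} = (q-5)(a^k)_{n}+(q-4)(b^k)_{n}-2 (q-4).$$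
   Context: The hyperbolic Pascal triangle $\mathcal{HPT}_{4,q}$ ($q\ge5$) is an array of rows of positive integers, each element having a type $A$ or $B$, built as follows. Row $0$ is the single element $1$. Row $1$ consists of two elements $1,1$, both of type $B$. The first and last elements of each row $n\ge 1$ (the wingers) have value $1$ and are regarded as type $B$. Given row $n\ge1$, with elements $x_0,x_1,\dots,x_{s_n-1}$ from left to right, row $n+1$ consists, from left to right, of: a left winger of value $1$ (type $B$); then an element $x_0+x_1$ of type $A$; then, for each $i=1,\dots,s_n-2$ in order, first $q-4$ copies of $x_i$ (if $x_i$ has type $A$) or $q-3$ copies of $x_i$ (if $x_i$ has type $B$), all of these copies having type $B$, followed by an element $x_i+x_{i+1}$ of type $A$; and finally a right winger of value $1$ (type $B$). (For instance row $2$ is $1,2,1$, and row $3$ is $1,3,2,\dots,2,3,1$ with $q-4$ copies of $2$.) Notation: $(a^k)_n$ and $(b^k)_n$ are the sums of the $k$-th powers of the type $A$ elements and of the type $B$ elements of row $n$, respectively (wingers count as type $B$). For $i,j\ge1$, $(a^ib^j)_n$ is the sum of the products $x^iy^j$ over all pairs of consecutive elements $x,y$ of row $n$ ($x$ immediately to the left of $y$) with $x$ of type $A$ and $y$ of type $B$. Finally $u_n$ is the sum of the products $x^{k-1}y$ over all pairs of consecutive elements $x,y$ of row $n$ ($x$ immediately to the left of $y$) both of type $B$; two consecutive elements of type $B$ are always equal, so $u_n$ is also the sum of $x^{k-i}y^{i}$ over such pairs for every $1\le i\le k-1$. *)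

(* Defs.v *)
From mathcomp Require Import all_boot all_order all_algebra.

Local Open Scope nat_scope.

Inductive elt_type := TypeA | TypeB.

Definition isA (t : elt_type) : bool := if t is TypeA then true else false.
Definition isB (t : elt_type) : bool := if t is TypeB then true else false.

Definition elt : Type := nat * elt_type.

Definition winger : elt := (1, TypeB).

(* Subtraction is truncated; it is the usual one for q >= 4. *)
Definition ncopies (q : nat) (t : elt_type) : nat :=
  if t is TypeA then q - 4 else q - 3.

(* Below, [nth winger r i] is x_i; for rows of size at least 2 every index used
   is in range, so the default value plays no role. *)
Definition next_row (q : nat) (r : seq elt) : seq elt :=
  let x i := (nth winger r i).1 in
  let t i := (nth winger r i).2 in
  [:: winger, (x 0 + x 1, TypeA) &
   flatten [seq rcons (nseq (ncopies q (t i)) (x i, TypeB))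
                      (x i + x i.+1, TypeA)
           | i <- iota 1 (size r - 2)]
   ++ [:: winger]].

(* Row 0 is the single element 1; its type is irrelevant and is set to B. *)
Fixpoint hpt_row (q n : nat) : seq elt :=
  match n with
  | 0 => [:: winger]
  | 1 => [:: winger; winger]
  | m.+1 => next_row q (hpt_row q m)
  end.

Definition consecutive (r : seq elt) : seq (elt * elt) := zip r (behead r).

(* (a^k)_n *)
Definition sumA (q n k : nat) : nat :=
  \sum_(x <- hpt_row q n | isA x.2) x.1 ^ k.

(* (b^k)_n *)
Definition sumB (q n k : nat) : nat :=
  \sum_(x <- hpt_row q n | isB x.2) x.1 ^ k.

(* (a^i b^j)_n *)
Definition sumAB (q n i j : nat) : nat :=
  \sum_(p <- consecutive (hpt_row q n) | isA p.1.2 && isB p.2.2)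
    p.1.1 ^ i * p.2.1 ^ j.

(* u_n; the exponent k is a parameter. *)
Definition sumBB (q n k : nat) : nat :=
  \sum_(p <- consecutive (hpt_row q n) | isB p.1.2 && isB p.2.2)
    p.1.1 ^ (k - 1) * p.2.1.

(* Main.v *)
Require Import Defs.
From mathcomp Require Import all_boot all_order all_algebra.
From mathcomp Require Import zify.
Import GRing.Theory.

(** A row [n >= 1] is [1, m, 1] with a palindromic middle [m], no two adjacent
    elements of type A, and equal values at adjacent elements of type B.  The
    type A elements of the next row are the sums [x + y] over the adjacent pairs
    [x, y]; since [q >= 5] every element of [m] leaves at least one copy, so each
    of these sums is followed by a copy of [y].  Hence [(a^k)] and [(a^(k-j) b^j)]
    of the next row are the sums of [(x + y)^k] and [(x + y)^(k-j) y^j] over the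
    adjacent pairs.  The binomial formula is applied to each pair according to
    its types: pairs AB and BA contribute equally by the palindromic symmetry,
    and pairs BB have [x = y]. *)

Local Open Scope nat_scope.

(** * Sums over adjacent pairs of a row *)

Definition pair_sum (F : elt -> elt -> nat) (r : seq elt) : nat :=
  \sum_(p <- consecutive r) F p.1 p.2.

Lemma pair_sum1 F x : pair_sum F [:: x] = 0.
Proof. by rewrite /pair_sum big_nil. Qed.

Lemma pair_sum_cons F x y s :
  pair_sum F [:: x, y & s] = F x y + pair_sum F (y :: s).
Proof. by rewrite /pair_sum big_cons. Qed.

(** The element [x] is shared by both summands, so the pairs on either side of the cut are each
    counted once. *)
Lemma pair_sum_cat F s1 x s2 :
  pair_sum F (s1 ++ x :: s2) = pair_sum F (rcons s1 x) + pair_sum F (x :: s2).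
Proof.
elim: s1 => [|y [|z s1] IH]; first by rewrite pair_sum1.
  by rewrite /= !pair_sum_cons pair_sum1 addn0.
by rewrite /= !pair_sum_cons -addnA; congr (_ + _); exact: IH.
Qed.

Lemma pair_sum_rev F r : pair_sum F (rev r) = pair_sum (fun x y => F y x) r.
Proof.
elim: r => [|x [|y s] IH]; first by rewrite /pair_sum !big_nil.
  by rewrite !pair_sum1.
rewrite pair_sum_cons -IH !rev_cons -cats1 cat_rcons pair_sum_cat.
by rewrite pair_sum_cons pair_sum1 addn0 addnC.
Qed.

Lemma pair_sum_nseq F c y : pair_sum F (nseq c.+1 y) = c * F y y.
Proof.
elim: c => [|c IH]; first by rewrite pair_sum1.
by rewrite [nseq _ _]/= pair_sum_cons -[y :: nseq c y]/(nseq c.+1 y) IH mulSn.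
Qed.

Lemma pair_sum_snd (f : elt -> nat) x s :
  pair_sum (fun _ y => f y) (x :: s) = \sum_(y <- s) f y.
Proof.
elim: s x => [|y s IH] x; first by rewrite pair_sum1 big_nil.
by rewrite pair_sum_cons big_cons IH.
Qed.

Lemma pair_sum_fst (f : elt -> nat) s z :
  pair_sum (fun x _ => f x) (rcons s z) = \sum_(y <- s) f y.
Proof.
rewrite -(pair_sum_rev (fun _ y => f y)) rev_rcons pair_sum_snd.
exact: big_rev.
Qed.

Lemma pair_sumD F G r :
  pair_sum (fun x y => F x y + G x y) r = pair_sum F r + pair_sum G r.
Proof. exact: big_split. Qed.

Lemma pair_sumZ c F r : pair_sum (fun x y => c * F x y) r = c * pair_sum F r.
Proof. by rewrite /pair_sum big_distrr. Qed.

Lemma pair_sum_lincomb (I : Type) (l : seq I) (c : I -> nat)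
    (F : I -> elt -> elt -> nat) r :
  pair_sum (fun x y => \sum_(i <- l) c i * F i x y) r =
  \sum_(i <- l) c i * pair_sum (F i) r.
Proof.
by rewrite /pair_sum exchange_big; apply: eq_bigr => i _; rewrite big_distrr.
Qed.

(** * Types of neighbours and passage to the next row *)

Definition adjacent (x y : elt) : bool :=
  (isB x.2 || isB y.2) && (isB x.2 && isB y.2 ==> (x.1 == y.1)).

Lemma eq_pair_sum F G r : sorted adjacent r ->
  (forall x y, adjacent x y -> F x y = G x y) -> pair_sum F r = pair_sum G r.
Proof.
move=> + FG; elim: r => [|x [|y s] IH]; rewrite ?pair_sum1 //.
  by rewrite /pair_sum !big_nil.
by rewrite !pair_sum_cons => /andP[/FG -> /IH ->].
Qed.

(* The part of the next row strictly between the first copies of [x] and the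
   last copies of [z], for a stretch [x, m, z] of the current row. *)
Fixpoint children (q : nat) (x : elt) (m : seq elt) (z : elt) : seq elt :=
  if m is y :: m' then
    (x.1 + y.1, TypeA) ::
      nseq (ncopies q y.2) (y.1, TypeB) ++ children q y m' z
  else [:: (x.1 + z.1, TypeA)].

Lemma children_cat q x m1 y m2 z :
  children q x (m1 ++ y :: m2) z =
  children q x m1 y ++ nseq (ncopies q y.2) (y.1, TypeB) ++ children q y m2 z.
Proof. by elim: m1 x => //= x1 m1 IH x; rewrite IH catA. Qed.

Lemma nseqSr (T : Type) c (x : T) : nseq c.+1 x = rcons (nseq c x) x.
Proof. by rewrite -addn1 nseqD cats1. Qed.

(** Addition commutes and each block of copies is constant; this carries the palindromic symmetry
    from row to row. *)
Lemma rev_children q x m z : rev (children q x m z) = children q z (rev m) x.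
Proof.
elim: m x => [|y m IH] x; first by rewrite /= addnC.
rewrite [children q x (y :: m) z]/= !rev_cons rev_cat IH rev_nseq.
by rewrite -(cats1 (rev m)) children_cat -cats1 catA addnC.
Qed.

(** Replaces the indexed definition of a row by the structural recursion on which the later
    inductions run. *)
Lemma next_rowE q x m z :
  next_row q (x :: rcons m z) = winger :: rcons (children q x m z) winger.
Proof.
rewrite /next_row -(cats1 (children _ _ _ _)); congr cons.
(* Here [size r - 2] is [size m], so the indices from 1 on run exactly over [m]. *)
rewrite -cat_cons; congr cat; rewrite /= size_rcons !subSS subn0; elim: m x => [|y m IH] x //=.
rewrite -IH cat_rcons; congr [:: _ & _ ++ _ :: flatten _].
by rewrite (iotaDl 1 1) -map_comp; apply: eq_map.
Qed.

Section Children.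
Variables (q : nat) (hq : 5 <= q).

Lemma ncopies_gt0 t : 0 < ncopies q t.
Proof. by case: t => /=; rewrite subn_gt0; lia. Qed.

(** Nonempty blocks of copies keep the type A elements apart. In the induction, [w] becomes the last
    copy of the preceding block. *)
Lemma sorted_children w x m z w' : isB w.2 -> isB w'.2 ->
  sorted adjacent (w :: rcons (children q x m z) w').
Proof.
move=> + w'B; elim: m w x => [|y m IH] w x wB.
  by rewrite /= /adjacent /= wB w'B andbF.
rewrite [children _ _ _ _]/= -(prednK (ncopies_gt0 y.2)).
set b := (y.1, TypeB); rewrite rcons_cons rcons_cat /= /adjacent /= wB andbF /=.
rewrite -/adjacent; elim: (_.-1) => [|c IHc]; first exact: IH.
by rewrite /= {1}/adjacent eqxx.
Qed.

Lemma sumA_children k x m z :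
  \sum_(e <- children q x m z | isA e.2) e.1 ^ k =
  pair_sum (fun x y => (x.1 + y.1) ^ k) (x :: rcons m z).
Proof.
elim: m x => [|y m IH] x; rewrite [children _ _ _ _]/= big_cons.
  by rewrite big_nil pair_sum_cons pair_sum1.
by rewrite rcons_cons pair_sum_cons big_cat big_nseq_cond /= IH.
Qed.

Lemma sumB_children k x m z :
  \sum_(e <- children q x m z | isB e.2) e.1 ^ k =
  \sum_(y <- m) ncopies q y.2 * y.1 ^ k.
Proof.
elim: m x => [|y m IH] x; rewrite [children _ _ _ _]/= big_cons ?big_nil //.
by rewrite big_cons big_cat big_nseq_cond iter_addn_0 mulnC IH.
Qed.

(** Pairs BA vanish by hypothesis, pairs AB are a sum followed by a copy of its right summand, and a
    block of [c] copies contains [c - 1] pairs BB. *)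
Lemma pair_sum_children (F : elt -> elt -> nat) w x m z :
  (forall x y, isB x.2 -> isA y.2 -> F x y = 0) -> isB w.2 ->
  pair_sum F (w :: rcons (children q x m z) (z.1, TypeB)) =
  pair_sum (fun x y => F (x.1 + y.1, TypeA) (y.1, TypeB)) (x :: rcons m z) +
  \sum_(y <- m) (ncopies q y.2).-1 * F (y.1, TypeB) (y.1, TypeB).
Proof.
move=> F0; elim: m w x => [|y m IH] w x wB.
  by rewrite big_nil /= !pair_sum_cons !pair_sum1 F0 // !addn0.
rewrite rcons_cons pair_sum_cons big_cons [children _ _ _ _]/=.
rewrite -{1}(prednK (ncopies_gt0 y.2)); move: (_.-1) => c.
set b := (y.1, TypeB); rewrite rcons_cons rcons_cat.
(* The last copy [b] is split off to serve as [w] in the induction hypothesis. *)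
rewrite nseqSr cat_rcons -!cat_cons pair_sum_cat IH //= pair_sum_cons F0 //.
by rewrite -nseqSr /= pair_sum_cons -[b :: _]/(nseq c.+1 b) pair_sum_nseq; lia.
Qed.

End Children.

(** * Binomial expansion at one adjacent pair *)

Definition AB (i j : nat) (x y : elt) : nat :=
  if isA x.2 && isB y.2 then x.1 ^ i * y.1 ^ j else 0.

Definition BB (k : nat) (x y : elt) : nat :=
  if isB x.2 && isB y.2 then x.1 ^ (k - 1) * y.1 else 0.

Lemma sumABE q n i j : sumAB q n i j = pair_sum (AB i j) (hpt_row q n).
Proof. exact: big_mkcond. Qed.

Lemma sumBBE q n k : sumBB q n k = pair_sum (BB k) (hpt_row q n).
Proof. exact: big_mkcond. Qed.

Lemma big_AB (I : eqType) (l : seq I) (c i j : I -> nat) x y :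
  \sum_(u <- l) c u * AB (i u) (j u) x y =
  if isA x.2 && isB y.2 then \sum_(u <- l) c u * (x.1 ^ i u * y.1 ^ j u) else 0.
Proof.
by rewrite /AB; case: ifP => // _; rewrite big1 // => u _; rewrite muln0.
Qed.

Lemma expnD_adjacent k x y : 2 <= k -> adjacent x y ->
  (x.1 + y.1) ^ k =
  x.1 ^ k + y.1 ^ k + \sum_(1 <= i < k) 'C(k, i) * AB (k - i) i x y
  + \sum_(1 <= i < k) 'C(k, i) * AB (k - i) i y x + (2 ^ k - 2) * BB k x y.
Proof.
move=> hk.
have E a b : (a + b) ^ k =
    a ^ k + b ^ k + \sum_(1 <= i < k) 'C(k, i) * (a ^ (k - i) * b ^ i).
  rewrite expnDn -(big_mkord xpredT (fun i => 'C(k, i) * (a ^ (k - i) * b ^ i))).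
  rewrite big_nat_recr //= big_ltn; last lia.
  by rewrite bin0 binn subn0 subnn !expn0; lia.
case: x y => [a []] [b []] //; rewrite /adjacent !big_AB /BB /=.
- by rewrite muln0 !addn0 E.
- by rewrite muln0 !addn0 addnC E (addnC (b ^ k)).
move=> /eqP <-; rewrite -expnSr subn1 prednK; last lia.
rewrite !addn0 addnn -mul2n expnMn.
(* This bound makes the truncated subtraction [2 ^ k - 2] exact. *)
have : 2 ^ 2 <= 2 ^ k by rewrite leq_exp2l.
move: (2 ^ k) (a ^ k) => s t ?; nia.
Qed.

(** The last binomial term, [i = k - j], is [y^k] whatever the types, so it stays outside the type
    tests. *)
Lemma expnD_mul_adjacent k j x y : 1 <= j <= k - 1 -> adjacent x y ->
  (x.1 + y.1) ^ (k - j) * y.1 ^ j =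
  y.1 ^ k + \sum_(0 <= i < k - j) 'C(k - j, i) * AB (k - j - i) (j + i) x y
  + \sum_(0 <= i < k - j) 'C(k - j, i) * AB (j + i) (k - j - i) y x
  + (2 ^ (k - j) - 1) * BB k x y.
Proof.
move=> hj; set m := k - j; have kE : k = m + j by lia.
have E a b : (a + b) ^ m * b ^ j =
    b ^ k + \sum_(0 <= i < m) 'C(m, i) * (a ^ (m - i) * b ^ (j + i)).
  rewrite expnDn -(big_mkord xpredT (fun i => 'C(m, i) * (a ^ (m - i) * b ^ i))).
  rewrite big_nat_recr //= binn subnn expn0 !mul1n mulnDl -expnD -kE addnC.
  congr (_ + _); rewrite big_distrl; apply: eq_bigr => i _ /=.
  by rewrite expnD; lia.
case: x y => [a []] [b []] //; rewrite /adjacent !big_AB /BB /=.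
- by rewrite muln0 !addn0 E.
- move=> _; rewrite muln0 !addn0 E; congr (_ + _); apply: eq_bigr => i _.
  by rewrite (mulnC (a ^ _)).
move=> /eqP <-; have -> : a ^ (k - 1) * a = a ^ k.
  by rewrite -expnSr; congr (_ ^ _); lia.
rewrite !addn0 addnn -mul2n expnMn -mulnA -expnD -kE.
have : 2 ^ 0 < 2 ^ m by rewrite ltn_exp2l //; lia.
move: (2 ^ m) (a ^ k) => s t ?; nia.
Qed.

Lemma hpt_row_spec q n : 5 <= q -> 1 <= n ->
  exists m, [/\ hpt_row q n = winger :: rcons m winger, rev m = m,
    sorted adjacent (winger :: rcons m winger) &
    hpt_row q n.+1 = winger :: rcons (children q winger m winger) winger].
Proof.
move=> hq; case: n => // n _; elim: n => [|n [m [_ mrev _ rowS]]].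
  by exists [::]; split=> //; rewrite /= (next_rowE q winger [::]).
exists (children q winger m winger); split=> //.
- by rewrite rev_children mrev.
- exact: sorted_children.
by rewrite -[LHS]/(next_row q (hpt_row q n.+2)) rowS next_rowE.
Qed.

(** * The recurrences over the natural numbers *)

Section Recurrences.
Variables (q k n : nat) (hq : 5 <= q) (hn : 1 <= n).

Lemma pair_sum_AB_sym i j :
  pair_sum (fun x y => AB i j y x) (hpt_row q n) = sumAB q n i j.
Proof.
have [m [rowE mrev _ _]] := hpt_row_spec q n hq hn.
rewrite sumABE -(pair_sum_rev (AB i j)); congr (pair_sum _ _).
by rewrite rowE rev_cons rev_rcons mrev.
Qed.

Lemma sumAB_total m : hpt_row q n = winger :: rcons m winger ->
  sumA q n k + sumB q n k = \sum_(x <- m) x.1 ^ k + 2.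
Proof.
move=> rowE; rewrite /sumA /sumB.
have -> : \sum_(x <- hpt_row q n | isB x.2) x.1 ^ k =
          \sum_(x <- hpt_row q n | ~~ isA x.2) x.1 ^ k.
  by apply: eq_bigl => -[? []].
rewrite -(bigID _ xpredT) rowE big_cons big_rcons /= exp1n.
by rewrite addnC -addnA.
Qed.

(** Summing [x^k + y^k] over adjacent pairs counts each winger once and every other element twice,
    whence the correction 2, put on the left to avoid truncated subtraction. *)
Lemma sumA_rec : 2 <= k ->
  sumA q n.+1 k + 2 =
  2 * sumA q n k + 2 * (\sum_(1 <= i < k) 'C(k, i) * sumAB q n (k - i) i)
  + 2 * sumB q n k + (2 ^ k - 2) * sumBB q n k.
Proof.
move=> hk; have [m [rowE _ srt rowS]] := hpt_row_spec q n hq hn.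
have tot := sumAB_total _ rowE.
rewrite {1}/sumA rowS big_cons big_rcons /= sumA_children.
rewrite (eq_pair_sum _ _ _ srt (fun x y => expnD_adjacent k x y hk)).
rewrite !pair_sumD !pair_sum_lincomb pair_sumZ -rowE -sumBBE.
under eq_bigr do rewrite -sumABE.
under [X in _ + X + (_ - _) * _]eq_bigr do rewrite pair_sum_AB_sym.
rewrite {1 2}rowE -rcons_cons pair_sum_fst rcons_cons pair_sum_snd.
by rewrite big_cons big_rcons /= exp1n -/(sumA q n k); lia.
Qed.

(** Summing [y^k] over adjacent pairs omits only the left winger, whence the correction 1. *)
Lemma sumAB_rec j : 1 <= j <= k - 1 ->
  sumAB q n.+1 (k - j) j + 1 =
  sumA q n k
  + \sum_(0 <= i < k - j) 'C(k - j, i) * sumAB q n (k - j - i) (j + i)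
  + \sum_(0 <= i < k - j) 'C(k - j, i) * sumAB q n (j + i) (k - j - i)
  + sumB q n k + (2 ^ (k - j) - 1) * sumBB q n k.
Proof.
move=> hj; have [m [rowE _ srt rowS]] := hpt_row_spec q n hq hn.
have tot := sumAB_total _ rowE.
rewrite sumABE rowS pair_sum_children //; last by move=> [? []] [? []].
(* Pairs inside a block of copies are BB and contribute nothing to [AB]. *)
rewrite {2}/AB /= big1 => [|? _]; last by rewrite muln0.
rewrite (eq_pair_sum _ _ _ srt (fun x y => expnD_mul_adjacent k j x y hj)).
rewrite !pair_sumD !pair_sum_lincomb pair_sumZ -rowE -sumBBE.
under eq_bigr do rewrite -sumABE.
under [X in _ + X + (_ - _) * _]eq_bigr do rewrite pair_sum_AB_sym.
by rewrite {1}rowE pair_sum_snd big_rcons /= exp1n; lia.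
Qed.

(** The weight [w] will count the copies in a block, or the pairs inside it; [2 * w TypeB] accounts
    for the wingers, which [m] leaves out. *)
Lemma sum_weighted m (w : elt_type -> nat) :
  hpt_row q n = winger :: rcons m winger ->
  \sum_(y <- m) w y.2 * y.1 ^ k + 2 * w TypeB =
  w TypeA * sumA q n k + w TypeB * sumB q n k.
Proof.
move=> rowE; rewrite /sumA /sumB rowE !big_cons !big_rcons /= exp1n.
have -> : \sum_(y <- m) w y.2 * y.1 ^ k =
    w TypeA * \sum_(y <- m | isA y.2) y.1 ^ k +
    w TypeB * \sum_(y <- m | isB y.2) y.1 ^ k.
  elim: (m) => [|[y []] s IH]; rewrite ?big_nil ?muln0 // !big_cons /= IH; lia.
lia.
Qed.

(** The old wingers have no copies, a deficit of [2 * (q - 3)], and the two new wingers reduce it to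
    [2 * (q - 4)]. *)
Lemma sumB_rec :
  sumB q n.+1 k + 2 * (q - 4) = (q - 4) * sumA q n k + (q - 3) * sumB q n k.
Proof.
have [m [rowE _ _ rowS]] := hpt_row_spec q n hq hn.
have := sum_weighted m (ncopies q) rowE.
rewrite [sumB q n.+1 k]/sumB rowS big_cons big_rcons /= sumB_children exp1n.
by lia.
Qed.

(** The new wingers have neighbours of type A, so only pairs inside blocks count: one fewer than the
    copies. *)
Lemma sumBB_rec : 2 <= k ->
  sumBB q n.+1 k + 2 * (q - 4) = (q - 5) * sumA q n k + (q - 4) * sumB q n k.
Proof.
move=> hk; have [m [rowE _ _ rowS]] := hpt_row_spec q n hq hn.
have W := sum_weighted m (fun t => (ncopies q t).-1) rowE.
have BBk a : BB k (a, TypeB) (a, TypeB) = a ^ k.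
  by rewrite /BB /= -expnSr; congr (_ ^ _); lia.
rewrite sumBBE rowS pair_sum_children //; last by move=> [? []] [? []].
rewrite [pair_sum _ _]big1 // add0n; under eq_bigr do rewrite BBk.
by rewrite /= -!subn1 -!subnDA in W.
Qed.

End Recurrences.

(** * Transfer to the integers *)

Local Open Scope ring_scope.

Theorem mainTheorem2 (q k : nat) (hq : (5 <= q)%N) (hk : (2 <= k)%N)
    (n : nat) (hn : (1 <= n)%N) :
  [/\ (sumA q n.+1 k)%:Z =
        2 * (sumA q n k)%:Z
        + 2 * (\sum_(1 <= i < k) 'C(k, i)%:Z * (sumAB q n (k - i) i)%:Z)
        + 2 * (sumB q n k)%:Z + (2 ^+ k - 2) * (sumBB q n k)%:Z - 2,
      forall j : nat, (1 <= j <= k - 1)%N ->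
        (sumAB q n.+1 (k - j) j)%:Z =
          (sumA q n k)%:Z
          + \sum_(0 <= i < k - j)
              'C(k - j, i)%:Z * (sumAB q n (k - j - i) (j + i))%:Z
          + \sum_(0 <= i < k - j)
              'C(k - j, i)%:Z * (sumAB q n (j + i) (k - j - i))%:Z
          + (sumB q n k)%:Z + (2 ^+ (k - j) - 1) * (sumBB q n k)%:Z - 1,
      (sumB q n.+1 k)%:Z =
        (q%:Z - 4) * (sumA q n k)%:Z + (q%:Z - 3) * (sumB q n k)%:Z
        - 2 * (q%:Z - 4)
    & (sumBB q n.+1 k)%:Z =
        (q%:Z - 5) * (sumA q n k)%:Z + (q%:Z - 4) * (sumB q n k)%:Z
        - 2 * (q%:Z - 4)].
Proof.
have pow2 m : (2 : int) ^+ m = (2 ^ m)%N%:Z by rewrite -natz natrX.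
have sumZ a b (c f : nat -> nat) :
    \sum_(a <= i < b) (c i)%:Z * (f i)%:Z = (\sum_(a <= i < b) c i * f i)%N%:Z.
  by rewrite (big_morph Posz PoszD (erefl _)); apply: eq_bigr => i _; rewrite PoszM.
split.
- have := sumA_rec q k n hq hn hk.
  (* With this bound the truncated [2 ^ k - 2] agrees with the integer difference. *)
  have : (2 ^ 1 <= 2 ^ k)%N by rewrite leq_exp2l // ltnW.
  by rewrite sumZ pow2; move: (2 ^ k)%N (\sum_(_ <= i < _) _)%N => ? ?; nia.
- move=> j hj; have := sumAB_rec q k n hq hn j hj.
  have : (0 < 2 ^ (k - j))%N by rewrite expn_gt0.
  rewrite !sumZ pow2.
  by move: (2 ^ _)%N (\sum_(_ <= i < _) _)%N (\sum_(_ <= i < _) _)%N => ? ? ?; nia.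
- by have := sumB_rec q k n hq hn; nia.
- by have := sumBB_rec q k n hq hn hk; nia.
Qed.
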